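(* Let $M$ be a finite simplicial complex and let $K$ be a finite covering complex of $M$ (that is, there is a covering map $\phi:K\to M$). Then $\beta_i(K)\ge\beta_i(M)$ for all $i\ge 0$, where $\beta_i$ denotes the dimension of the $i$-th reduced cohomology group $\tilde H^i(\cdot,\mathbb{R})$.
   Context: A complex $K$ is a collection of subsets of a finite set closed under inclusion, with $\emptyset\in K$ (dimension $-1$). $S_i(K)$ is the set of $i$-faces (faces with $i+1$ elements), $V(K)$ the vertex set. $K$ is connected if the graph formed by its vertices and $1$-faces is connected. For $\bar F\in S_{i+1}(K)$, $\partial\bar F$ is the set of $i$-faces contained in $\bar F$. $\tilde H^i(K,\mathbb{R})=\ker\delta_i/\operatorname{im}\delta_{i-1}$ is the cohomology of the augmented simplicial cochain complex of $K$ (including $C^{-1}(K,\mathbb{R})$, generated by the empty face), and $\beta_i(K)=\dim\tilde H^i(K,\mathbb{R})$. A simplicial map $\phi:K\to M$ is a map $V(K)\to V(M)$ sending faces to faces; $F\in\phi^{-1}(G)$ means $F\in K$ and $\phi(F)=G$. A covering map (all coverings are strong) is a simplicial map $\phi:K\to M$ such that: $K$ is connected; for each $G\in M$, the set $\phi^{-1}(G)$ is nonempty, the vertices of $K$ lying over $G$ are the union of the simplices $F\in\phi^{-1}(G)$, for $G\neq\emptyset$ these simplices are pairwise disjoint, and each restriction $\phi|_F:F\to G$ is a bijection; and whenever $G\in S_i(M)$ is a face of $\bar G\in S_{i+1}(M)$, for each $F\in\phi^{-1}(G)$ there is $\bar F\in S_{i+1}(K)$ with $F\in\partial\bar F$ and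 $\phi(\bar F)=\bar G$. *)

(* Defs.v *)
From HB Require Import structures.
From mathcomp Require Import all_boot all_order all_algebra.
From mathcomp Require Import reals.

Set Implicit Arguments.
Unset Strict Implicit.
Unset Printing Implicit Defensive.

Import Order.TTheory GRing.Theory Num.Theory.
Local Open Scope ring_scope.

(* Not every point of the ground type [T] has to be a vertex. *)
Record scomplex (T : finType) := SComplex {
  faces :> {set {set T}};
  faces_set0 : set0 \in faces;
  faces_down : forall F G : {set T}, F \in faces -> G \subset F -> G \in faces
}.

(* Faces are graded by cardinality: [nfaces K n] is S_(n-1)(K), so that the
   empty face is the one of degree 0. *)
Definition nfaces (T : finType) (K : scomplex T) (n : nat) : {set {set T}} :=
  [set F in K | #|F| == n].

Definition vertex (T : finType) (K : scomplex T) : finType :=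
  {x : T | [set x] \in K}.

Definition adjacent (T : finType) (K : scomplex T) : rel (vertex K) :=
  fun x y => (x != y) && ([set val x; val y] \in K).

Definition connected (T : finType) (K : scomplex T) : Prop :=
  forall x y : vertex K, connect (@adjacent T K) x y.

Section Coverings.
Variables (T U : finType) (K : scomplex T) (M : scomplex U).
Variable phi : vertex K -> vertex M.

Definition face_image (F : {set T}) : {set U} :=
  [set val (phi x) | x : vertex K & val x \in F].

Definition simplicial : Prop := forall F, F \in K -> face_image F \in M.

Definition face_fibre (G : {set U}) : {set {set T}} :=
  [set F in K | face_image F == G].

(* In [covering_inj], the restriction of [phi] to F is onto G by definition of
   the fibre, so that injectivity makes it a bijection. *)
Record covering : Prop := Covering {
  covering_simplicial : simplicial;
  covering_connected : connected K;
  covering_nonempty : forall G, G \in M -> face_fibre G != set0;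
  covering_vertices : forall G, G \in M ->
    [set val x | x : vertex K & val (phi x) \in G] = cover (face_fibre G);
  covering_disjoint : forall G, G \in M -> G != set0 ->
    trivIset (face_fibre G);
  covering_inj : forall G F, G \in M -> F \in face_fibre G ->
    {in [pred x : vertex K | val x \in F] &, injective phi};
  covering_lift : forall n G Gbar F,
    G \in nfaces M n -> Gbar \in nfaces M n.+1 -> G \subset Gbar ->
    F \in face_fibre G ->
    exists Fbar, [/\ Fbar \in nfaces K n.+1, F \subset Fbar
                   & face_image Fbar = Gbar]
}.

End Coverings.

Section Cohomology.
Variables (R : realType) (T : finType) (K : scomplex T).

Definition nface (n : nat) : finType := {F : {set T} | F \in nfaces K n}.

(* Each face is oriented by the enumeration order of [T], so that a cochain is
   determined by its values on (unoriented) faces; [cochain n] is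
   C^(n-1)(K, R), and [cochain 0] is spanned by the empty face. *)
Definition cochain (n : nat) : vectType R := {ffun nface n -> R^o}.

(* The sign of [F] in the oriented boundary of [Fbar]: if
   Fbar = {v_0 < ... < v_n} and F omits v_j, then exactly j vertices of F
   precede v_j, and the sign is (-1)^j. *)
Definition incidence (Fbar F : {set T}) : R :=
  (-1) ^+ #|[set u in F | [exists v in Fbar :\: F,
                            (enum_rank u < enum_rank v)%N]]|.

Definition coboundary_fun (n : nat) (f : cochain n) : cochain n.+1 :=
  [ffun Fbar : nface n.+1 =>
     \sum_(F : nface n | val F \subset val Fbar)
        incidence (val Fbar) (val F) * f F].

Lemma coboundary_fun_is_linear (n : nat) : linear (@coboundary_fun n).
Proof.
move=> a f g; apply/ffunP=> Fb; rewrite !ffunE scaler_sumr -big_split /=.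
by apply: eq_bigr => F _; rewrite !ffunE mulrDr /GRing.scale /= mulrCA.
Qed.

HB.instance Definition _ (n : nat) :=
  GRing.isLinear.Build R (cochain n) (cochain n.+1) _ (@coboundary_fun n)
    (@coboundary_fun_is_linear n).

(* The map delta_(n-1) : C^(n-1)(K, R) -> C^n(K, R). *)
Definition coboundary (n : nat) : 'Hom(cochain n, cochain n.+1) :=
  linfun (@coboundary_fun n).

Lemma incidenceU1 (F : {set T}) (v : T) : v \notin F ->
  incidence (v |: F) F =
    (-1) ^+ #|[set u in F | (enum_rank u < enum_rank v)%N]|.
Proof.
move=> vF; rewrite /incidence; congr (_ ^+ #|pred_of_set _|).
apply/setP=> u; rewrite !inE; congr (_ && _).
apply/existsP/idP => [[w /andP[]]|uv].
  by rewrite !inE => /andP[/negPf wF]; rewrite wF orbF => /eqP->.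
by exists v; rewrite !inE vF eqxx.
Qed.

Lemma card_precU1 (F : {set T}) (a v : T) : a \notin F ->
  #|[set u in a |: F | (enum_rank u < enum_rank v)%N]| =
    ((enum_rank a < enum_rank v)
       + #|[set u in F | (enum_rank u < enum_rank v)%N]|)%N.
Proof.
move=> aF; rewrite (cardsD1 a) !inE eqxx /=; congr (_ + #|pred_of_set _|)%N.
apply/setP=> u; rewrite !inE; case: eqP => [->|] //=.
by rewrite (negPf aF).
Qed.

Lemma incidence_cancel (F : {set T}) (a b : T) :
  a \notin F -> b \notin F -> a != b ->
  incidence (a |: (b |: F)) (b |: F) * incidence (b |: F) F
    + incidence (a |: (b |: F)) (a |: F) * incidence (a |: F) F = 0.
Proof.
move=> aF bF ab; rewrite {2}setUCA !incidenceU1 ?inE ?negb_or ?ab //.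
  have nlt : (enum_rank a < enum_rank b)%N = ~~ (enum_rank b < enum_rank a)%N.
    rewrite -leqNgt ltn_neqAle andb_idl // => _.
    by apply: contraNneq ab => /ord_inj/enum_rank_inj->.
  have sgn0 (c : bool) (x y : nat) : (-1) ^+ (~~ c + x) * (-1) ^+ y
      + (-1) ^+ (c + y) * (-1) ^+ x = 0 :> R.
    case: c; rewrite ?add0n ?add1n exprS mulN1r mulNr.
      by rewrite [X in _ - X]mulrC subrr.
    by rewrite [X in _ + X]mulrC addNr.
  by rewrite !card_precU1 // nlt addrC sgn0.
by rewrite eq_sym ab.
Qed.

Lemma nfaceP (n : nat) (F : nface n) : val F \in K /\ #|val F| = n.
Proof. by case: F => F /=; rewrite inE => /andP[FK /eqP]. Qed.

Lemma coboundaryK (n : nat) (f : cochain n) :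
  coboundary n.+1 (coboundary n f) = 0.
Proof.
rewrite !lfunE /=; apply/ffunP=> Fb; rewrite !ffunE.
under eq_bigr => G _ do rewrite ffunE mulr_sumr.
rewrite (exchange_big_dep predT) //= big1 // => F _.
under eq_bigr => G _ do rewrite mulrA.
rewrite -mulr_suml.
have [FFb|FFb] := boolP (val F \subset val Fb); last first.
  rewrite big1 ?mul0r // => G /andP[GFb FG].
  by rewrite (subset_trans FG GFb) in FFb.
have [[FbK cFb] [FK cF]] := (nfaceP Fb, nfaceP F).
have /cards2P[a [b [ab Eab]]] : #|val Fb :\: val F| == 2%N.
  by rewrite cardsD (setIidPr FFb) cFb cF -addn2 addKn.
have aE : a \in val Fb :\: val F by rewrite Eab !inE eqxx.
have bE : b \in val Fb :\: val F by rewrite Eab !inE eqxx orbT.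
move: (aE) (bE); rewrite !inE => /andP[aF aFb] /andP[bF bFb].
have EFb : val Fb = a |: (b |: val F).
  rewrite setUA -Eab; apply/setP=> u; rewrite !inE.
  by case: (boolP (u \in val F)) => uF; rewrite ?orbF ?orbT //= (subsetP FFb).
have down (c : T) : c \notin val F -> c \in val Fb ->
    c |: val F \in nfaces K n.+1.
  move=> cNF cFb'; rewrite inE cardsU1 cNF cF eqxx andbT.
  apply: (faces_down FbK).
  by rewrite subUset sub1set cFb'.
pose A : nface n.+1 := exist _ (a |: val F) (down a aF aFb).
pose B : nface n.+1 := exist _ (b |: val F) (down b bF bFb).
have AB : A != B.
  apply/eqP => /(congr1 val) /= /setP /(_ a).
  by rewrite !inE eqxx (negPf ab) (negPf aF).
rewrite (bigD1 B) /=; last by rewrite subsetUr EFb subsetUr.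
rewrite (bigD1 A) /=; last first.
  by rewrite subsetUr AB EFb subUset !sub1set !inE eqxx /= setUCA setUA subsetUr.
rewrite big1 ?addr0.
  by rewrite EFb incidence_cancel // mul0r.
move=> G /andP[/andP[/andP[GFb FG] GB] GA]; exfalso.
have [GK cG] := nfaceP G.
have /cards1P[c Ec] : #|val G :\: val F| == 1%N.
  by rewrite cardsD (setIidPr FG) cG cF subSnn.
have EG : val G = c |: val F.
  rewrite -Ec; apply/setP=> u; rewrite !inE.
  by case: (boolP (u \in val F)) => uF; rewrite ?orbF //= (subsetP FG).
have : c \in val Fb :\: val F.
  have : c \in val G :\: val F by rewrite Ec inE.
  by rewrite !inE => /andP[-> /(subsetP GFb)].
rewrite Eab !inE => /orP[] /eqP Ecab.
  by case/eqP: GA; apply: val_inj; rewrite EG Ecab.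
by case/eqP: GB; apply: val_inj; rewrite EG Ecab.
Qed.

(* This makes the (truncated) subtraction in [betti] exact. *)
Lemma limg_coboundary_sub (n : nat) :
  (limg (coboundary n) <= lker (coboundary n.+1))%VS.
Proof.
by apply/subvP=> _ /memv_imgP[f _ ->]; rewrite memv_ker coboundaryK.
Qed.

(* The dimension of ker delta_i / im delta_(i-1). *)
Definition betti (i : nat) : nat :=
  (\dim (lker (coboundary i.+1)) - \dim (limg (coboundary i)))%N.

End Cohomology.

(* Main.v *)
From HB Require Import structures.
Require Import Defs.
From mathcomp Require Import all_boot all_order all_algebra.
From mathcomp Require Import reals.

(** The cohomology of the base is a direct summand of that of the cover,
    because the pullback along the covering has a left inverse given by
    averaging over the sheets.

    With real coefficients and oriented faces, the pullback of a cochain [f]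
    is F |-> eps(F) f(phi(F)), where eps(F) is the sign of the permutation
    that compares the order of the vertices of F with that of their images
    ([sheet_sign]); it commutes with the coboundary since eps relates the
    incidence signs upstairs and downstairs ([sheet_sign_facet]).  The
    averaged transfer of a cochain [g] on the cover is the function sending G
    to the mean of eps(F) g(F) over the faces F above G.  As eps squares to 1,
    the transfer of a pullback is the original cochain ([pullbackK]).

    The transfer commutes with the coboundary because the fibres fit together
    uniformly: if G is a facet of Gb, all faces above G lie in the same number
    of faces above Gb ([card_cofacets_over]).  For G nonempty this number is 1,
    by the lifting property and the disjointness of the fibre of Gb.  For G
    empty it is the whole fibre of Gb, since the empty face is the only one
    above itself.  Taking means rather than sums is what makes the identity
    hold down to the augmentation, where the cardinality of the fibre jumps.

    The inequality of Betti numbers is then linear algebra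
    ([betti_le_of_retraction]). *)

Set Implicit Arguments.
Unset Strict Implicit.
Unset Printing Implicit Defensive.

Import Order.TTheory GRing.Theory Num.Theory.
Local Open Scope ring_scope.

(** * Cochain retractions and Betti numbers *)

(** The pullback [P] is injective on the cocycles ZM of M, and if [P f] is the
    coboundary of [g] then [f] = [t (P f)] is the coboundary of [t g].  So the
    intersection of [P @: ZM] with the coboundaries BK of K lies in the image
    of the coboundaries BM of M; the dimension formula for [P @: ZM] + BK, a
    subspace of the cocycles of K, concludes. *)
Lemma betti_le_of_retraction (R : realType) (T U : finType)
    (K : scomplex T) (M : scomplex U) (i : nat)
    (p : forall n, {linear cochain R M n -> cochain R K n})
    (t : forall n, cochain R K n -> cochain R M n) :
  (forall n f, coboundary R K n (p n f) = p n.+1 (coboundary R M n f)) ->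
  (forall n g, coboundary R M n (t n g) = t n.+1 (coboundary R K n g)) ->
  (forall n f, t n (p n f) = f) ->
  (betti R M i <= betti R K i)%N.
Proof.
move=> pd td tp; rewrite /betti.
set ZM := lker _; set BM := limg _; set ZK := lker _; set BK := limg _.
pose P := linfun (p i.+1).
have PE f : P f = p i.+1 f by rewrite lfunE.
have dimP : \dim (P @: ZM) = \dim ZM.
  apply: limg_dim_eq; apply/eqP; rewrite -subv0; apply/subvP=> f.
  rewrite memv_cap memv_ker PE memv0 => /andP[_ /eqP pf0].
  by rewrite -[f]tp pf0 -(linear0 (p i.+1)) tp.
have subZ : (P @: ZM + BK <= ZK)%VS.
  rewrite subv_add limg_coboundary_sub andbT.
  apply/subvP=> _ /memv_imgP[f + ->].
  by rewrite !memv_ker PE pd => /eqP->; rewrite linear0.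
have subB : (P @: ZM :&: BK <= P @: BM)%VS.
  apply/subvP=> h; rewrite memv_cap => /andP[/memv_imgP[f _ hf]].
  case/memv_imgP=> g _ hg; rewrite hf; apply: memv_img.
  rewrite -[f]tp -PE -hf hg -td; apply: memv_img; exact: memvf.
have := dimv_sum_cap (P @: ZM) BK; rewrite dimP => dimE.
have leZ := dimvS subZ; have leB := dimvS subB.
have leP : (\dim (P @: BM) <= \dim BM)%N.
  by rewrite -(limg_ker_dim P BM) leq_addl.
have leBZ : (\dim BK <= \dim ZK)%N by apply/dimvS/limg_coboundary_sub.
rewrite leq_subLR addnBA // leq_subRL ?(leq_trans leBZ) ?leq_addl //.
rewrite addnC -dimE [leqRHS]addnC; exact: leq_add leZ (leq_trans leB leP).
Qed.

(** * Incidence signs *)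

Definition precedes (T : finType) (u v : T) : bool :=
  (enum_rank u < enum_rank v)%N.

Lemma precedes_total (T : finType) (u v : T) :
  u != v -> precedes v u = ~~ precedes u v.
Proof.
move=> uv; rewrite /precedes -leqNgt ltn_neqAle andb_idl // => _.
by apply: contraNneq uv => /ord_inj/enum_rank_inj->.
Qed.

(** Written as a product over vertices, the sign can be pulled back along
    [phi] and compared vertex by vertex. *)
Lemma incidence_prod (R : realType) (T : finType) (F : {set T}) (v : T) :
  v \notin F ->
  incidence R (v |: F) F = \prod_(u in F) (-1) ^+ (precedes u v).
Proof.
move=> vF; rewrite incidenceU1 // -sum1_card -expr_sum; congr (_ ^+ _).
rewrite big_mkcond [RHS]big_mkcond /=; apply: eq_bigr => u _.
by rewrite !inE /precedes; case: (u \in F); case: (_ < _)%N.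
Qed.

Lemma facetU1 (T : finType) (F Fb : {set T}) (n : nat) :
  F \subset Fb -> #|F| = n -> #|Fb| = n.+1 ->
  exists2 v, v \notin F & Fb = v |: F.
Proof.
move=> FFb cF cFb.
have /cards1P[v Ev] : #|Fb :\: F| == 1%N.
  by rewrite cardsD (setIidPr FFb) cF cFb subSnn.
have : v \in Fb :\: F by rewrite Ev inE.
rewrite inE => /andP[vF _]; exists v => //.
by rewrite -Ev setUC setDE setUIr setUCr setIT; apply/esym/setUidPr.
Qed.

(** * The sign of a covering on a face *)

Section Covering.
Variables (R : realType) (T U : finType) (K : scomplex T) (M : scomplex U).
Variable phi : vertex K -> vertex M.

Definition vertices_in (F : {set T}) : {set vertex K} :=
  [set x | val x \in F].

Lemma vertices_inK (F : {set T}) :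
  F \in K -> [set val x | x in vertices_in F] = F.
Proof.
move=> FK; apply/setP=> u; apply/imsetP/idP => [[x + ->]|uF].
  by rewrite inE.
have uK : [set u] \in K by apply: faces_down FK _; rewrite sub1set.
by exists (exist _ u uK); rewrite ?inE.
Qed.

Lemma face_imageE (F : {set T}) :
  face_image phi F = [set val (phi x) | x in vertices_in F].
Proof. by apply: eq_imset => // x; rewrite !inE. Qed.

Lemma face_imageS (F F' : {set T}) :
  F \subset F' -> face_image phi F \subset face_image phi F'.
Proof.
move=> /subsetP FF'; rewrite !face_imageE; apply: imsetS.
by apply/subsetP=> x; rewrite !inE => /FF'.
Qed.

(** The sign of the permutation that sorts the images of the vertices of [F],
    computed by counting its inversions. *)
Definition sheet_sign (F : {set T}) : R :=
  \prod_(x in vertices_in F) \prod_(y in vertices_in F)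
    (-1) ^+ (precedes (val x) (val y) && precedes (val (phi y)) (val (phi x))).

Lemma sheet_sign_sqr (F : {set T}) : sheet_sign F * sheet_sign F = 1.
Proof.
rewrite -big_split big1 //= => x _; rewrite -big_split big1 //= => y _.
by rewrite -signr_addb addbb.
Qed.

Hypothesis cov : covering phi.

Lemma phi_inj_on (F : {set T}) :
  F \in K -> {in vertices_in F &, injective (fun x => val (phi x))}.
Proof.
move=> FK x y; rewrite !inE => xF yF /val_inj exy.
have Ffib : F \in face_fibre phi (face_image phi F) by rewrite inE FK eqxx.
exact: (covering_inj cov (covering_simplicial cov FK) Ffib) exy.
Qed.

(** Passing from [F] to [v |: F] creates the inversions between [v] and the
    vertices x of [F].  For each x the identity to check has two cases: v and
    x are inverted by [phi], so that the two incidence factors differ and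
    compensate the new inversion, or they are not and the factors agree. *)
Lemma sheet_signU1 (F : {set T}) (v : T) :
  v \notin F -> v |: F \in K ->
  sheet_sign (v |: F) * incidence R (v |: F) F
    = incidence R (face_image phi (v |: F)) (face_image phi F) * sheet_sign F.
Proof.
move=> vF FbK.
have FK : F \in K by apply: faces_down FbK _; apply: subsetUr.
have vK : [set v] \in K by apply: faces_down FbK _; apply: subsetUl.
pose a : vertex K := exist _ v vK.
have aF : a \notin vertices_in F by rewrite inE.
have EFb : vertices_in (v |: F) = a |: vertices_in F.
  by apply/setP=> x; rewrite !inE.
have injb := phi_inj_on FbK; rewrite EFb in injb.
have aFi x : x \in vertices_in F ->
    (val x != val a) && (val (phi x) != val (phi a)).
  move=> xF; have xa : x != a by apply: contraNneq aF => <-.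
  rewrite (inj_eq val_inj) xa; apply: contraNneq xa => /injb-> //.
    by rewrite inE xF orbT.
  by rewrite !inE eqxx.
have aFphi : val (phi a) \notin face_image phi F.
  rewrite face_imageE; apply/imsetP=> -[x xF eax].
  by case/andP: (aFi x xF); rewrite eax eqxx.
have EphiFb : face_image phi (v |: F) = val (phi a) |: face_image phi F.
  by rewrite !face_imageE EFb imsetU1.
have prodF : \prod_(u in F) (-1) ^+ precedes u v
    = \prod_(x in vertices_in F) (-1) ^+ precedes (val x) (val a) :> R.
  rewrite -{1}(vertices_inK FK) big_imset //= => x y _ _; exact: val_inj.
have prod_phiF : \prod_(u in face_image phi F) (-1) ^+ precedes u (val (phi a))
    = \prod_(x in vertices_in F)
        (-1) ^+ precedes (val (phi x)) (val (phi a)) :> R.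
  rewrite face_imageE big_imset //=; exact: phi_inj_on FK.
rewrite EphiFb !incidence_prod // prodF prod_phiF.
rewrite /sheet_sign EFb big_setU1 //= big_setU1 //=.
(* The diagonal pair of [v] with itself contributes 1; the pairs inside [F] form
   the sign of [F], which occurs on both sides. *)
under [X in _ * X * _]eq_bigr => x _ do rewrite big_setU1 //=.
rewrite big_split /= {1}/precedes ltnn /= expr0 mul1r mulrA [RHS]mulrC.
rewrite [_ * \prod_(x in _) \prod_(y in _) _]mulrC -!mulrA; congr (_ * _).
rewrite -!big_split /=; apply: eq_bigr => x /aFi /andP[xa phixa].
rewrite (precedes_total xa) (precedes_total phixa).
by case: (precedes (val x) _); case: (precedes _ _);
  rewrite ?expr0 ?expr1 ?mulr1 ?mul1r ?mulrNN ?mulr1.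
Qed.

(** * Faces and fibres of a covering *)

Lemma card_face_image (F : {set T}) :
  F \in K -> #|face_image phi F| = #|F|.
Proof.
move=> FK; rewrite face_imageE card_in_imset; last exact: phi_inj_on FK.
rewrite -[in RHS](vertices_inK FK) card_imset //; exact: val_inj.
Qed.

Lemma face_image_nface (n : nat) (F : nface K n) :
  face_image phi (val F) \in nfaces M n.
Proof.
have [FK cF] := nfaceP F; rewrite inE (covering_simplicial cov FK) /=.
by rewrite card_face_image // cF.
Qed.

Definition face_proj (n : nat) (F : nface K n) : nface M n :=
  exist _ (face_image phi (val F)) (face_image_nface F).

(** This is what makes both the pullback and the transfer commute with the
    coboundary. *)
Lemma sheet_sign_facet (n : nat) (F : nface K n) (Fb : nface K n.+1) :
  val F \subset val Fb ->
  sheet_sign (val Fb) * incidence R (val Fb) (val F)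
    = incidence R (val (face_proj Fb)) (val (face_proj F))
        * sheet_sign (val F).
Proof.
have [[FK cF] [FbK cFb]] := (nfaceP F, nfaceP Fb).
move=> /facetU1 /(_ cF cFb) [v vF EFb] /=.
by rewrite EFb; apply: sheet_signU1; rewrite // -EFb.
Qed.

(** [phi] is a bijection from [Fb] onto its image, hence also on facets: the
    one above [G] consists of the vertices of [Fb] that map into [G].
    Existence and uniqueness are packed into one equivalence so that it
    collapses a sum over the facets of [Fb] above [G] to a single term. *)
Lemma facet_over (n : nat) (Fb : nface K n.+1) (G : nface M n) :
  val G \subset val (face_proj Fb) ->
  exists F : nface K n, forall F' : nface K n,
    (val F' \subset val Fb) && (face_proj F' == G) = (F' == F).
Proof.
move=> GFb; have [FbK cFb] := nfaceP Fb; have [_ cG] := nfaceP G.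
pose S := [set val x | x : vertex K & (val x \in val Fb)
                                    && (val (phi x) \in val G)].
have SE x : (val x \in S) = (val x \in val Fb) && (val (phi x) \in val G).
  apply/imsetP/idP => [[y + /val_inj->]|xS]; first by rewrite inE.
  by exists x; rewrite ?inE.
have SFb : S \subset val Fb.
  by apply/subsetP=> _ /imsetP[x + ->]; rewrite inE => /andP[].
have SK := faces_down FbK SFb.
have imS : face_image phi S = val G.
  apply/setP=> u; rewrite face_imageE; apply/imsetP/idP => [[x + ->]|uG].
    by rewrite inE SE => /andP[].
  have := subsetP GFb _ uG; rewrite /= face_imageE => /imsetP[x + ux].
  by rewrite inE => xFb; exists x; rewrite // inE SE xFb -ux uG.
have cS : S \in nfaces K n.
  by rewrite inE SK -cG -imS card_face_image /=.
exists (exist _ S cS) => F'; apply/andP/eqP => [[F'Fb /eqP F'G]|->]; last first.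
  by split=> //; apply/eqP/val_inj.
have [F'K cF'] := nfaceP F'; apply: val_inj => /=.
apply/eqP; rewrite eqEcard cF'; move: cS; rewrite inE SK => /eqP->.
rewrite leqnn andbT -(vertices_inK F'K); apply/subsetP=> _ /imsetP[x + ->].
rewrite inE => xF'; rewrite SE (subsetP F'Fb) //= -F'G /= face_imageE.
by apply: imset_f; rewrite inE.
Qed.

Lemma card_fibre_gt0 (n : nat) (G : nface M n) :
  (0 < #|[set F : nface K n | face_proj F == G]|)%N.
Proof.
have [GM cG] := nfaceP G; have /set0Pn[F] := covering_nonempty cov GM.
rewrite inE => /andP[FK /eqP imF]; apply/card_gt0P.
have cF : F \in nfaces K n.
  by rewrite inE FK -cG -imF card_face_image /=.
by exists (exist _ F cF); rewrite inE; apply/eqP/val_inj.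
Qed.

Definition cofacets_over (n : nat) (Gb : nface M n.+1) (F : nface K n) :=
  [set Fb : nface K n.+1 | (face_proj Fb == Gb) && (val F \subset val Fb)].

(** The lifting property gives one such face.  Two of them would meet in the
    nonempty [F], against the disjointness of the fibre of [Gb]. *)
Lemma cofacet_over_unique (n : nat) (F : nface K n) (Gb : nface M n.+1) :
  (0 < n)%N -> val (face_proj F) \subset val Gb ->
  #|cofacets_over Gb F| = 1%N.
Proof.
move=> n_gt0 FGb; have [[FK cF] [GbM cGb]] := (nfaceP F, nfaceP Gb).
have Gb0 : val Gb != set0 by rewrite -card_gt0 cGb.
have /set0Pn[u uF] : val F != set0 by rewrite -card_gt0 cF.
have FfibG : val F \in face_fibre phi (val (face_proj F)) by rewrite inE FK /=.
have [Fb [Fbn FFb imFb]] :=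
  covering_lift cov (valP (face_proj F)) (valP Gb) FGb FfibG.
have inFib (F' : nface K n.+1) :
    face_proj F' == Gb -> val F' \in face_fibre phi (val Gb).
  by move/eqP<-; have [F'K _] := nfaceP F'; rewrite inE F'K /=.
apply/eqP/cards1P; exists (exist _ Fb Fbn); apply/setP=> F'; rewrite !inE.
apply/andP/eqP => [[/inFib F'fib FF']|->]; last first.
  by split=> //; apply/eqP/val_inj.
apply: val_inj => /=; apply/eqP; apply: contraTT isT => F'Fb.
have Fbfib : Fb \in face_fibre phi (val Gb).
  by apply: (inFib (exist _ Fb Fbn)); apply/eqP/val_inj.
have /trivIsetP/(_ _ _ F'fib Fbfib F'Fb) := covering_disjoint cov GbM Gb0.
by move/disjointFr/(_ (subsetP FF' _ uF)); rewrite (subsetP FFb _ uF).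
Qed.

Lemma nface0_eq (F F' : nface K 0) : F = F'.
Proof.
have [[_ /cards0_eq F0] [_ /cards0_eq F'0]] := (nfaceP F, nfaceP F').
by apply: val_inj; rewrite F0 F'0.
Qed.

(** Double counting of the pairs (F', Fb) with [Fb] above [Gb] and F' its facet
    above [face_proj F]: each [Fb] occurs once by [facet_over], and each F'
    equally often. *)
Lemma card_cofacets_over (n : nat) (F : nface K n) (Gb : nface M n.+1) :
  val (face_proj F) \subset val Gb ->
  (#|cofacets_over Gb F|
     * #|[set F' : nface K n | face_proj F' == face_proj F]|)%N
    = #|[set Fb : nface K n.+1 | face_proj Fb == Gb]|.
Proof.
move=> FGb; have cst F' : face_proj F' == face_proj F ->
    #|cofacets_over Gb F'| = #|cofacets_over Gb F|.
  case: n F Gb FGb F' => [|n] F Gb FGb F' => [_|/eqP F'F].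
    by rewrite (nface0_eq F F').
  by rewrite !cofacet_over_unique // F'F.
rewrite mulnC -sum_nat_const (eq_bigr (fun F' => #|cofacets_over Gb F'|));
  last by move=> F'; rewrite inE => /cst.
under eq_bigr => F' _ do rewrite -sum1_card.
rewrite (exchange_big_dep (fun Fb => face_proj Fb == Gb)) /=; last first.
  by move=> F' Fb _; rewrite inE => /andP[].
rewrite -sum1_card; apply: eq_big => [Fb|Fb /eqP FbGb]; first by rewrite inE.
have [|F0 F0P] := @facet_over n Fb (face_proj F); first by rewrite FbGb.
rewrite (big_pred1 F0) // => F'.
by rewrite !inE FbGb eqxx /= andbC F0P.
Qed.

(** * Pullback and averaged transfer *)

Definition pullback_fun (n : nat) (f : cochain R M n) : cochain R K n :=
  [ffun F => sheet_sign (val F) * f (face_proj F)].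

Lemma pullback_fun_is_linear (n : nat) : linear (@pullback_fun n).
Proof.
move=> a f g; apply/ffunP=> F; rewrite !ffunE mulrDr; congr (_ + _).
by rewrite /GRing.scale /= mulrCA.
Qed.

HB.instance Definition _ (n : nat) :=
  GRing.isLinear.Build R (cochain R M n) (cochain R K n) _ (@pullback_fun n)
    (@pullback_fun_is_linear n).

Definition transfer (n : nat) (g : cochain R K n) : cochain R M n :=
  [ffun G => #|[set F : nface K n | face_proj F == G]|%:R^-1
               * \sum_(F | face_proj F == G) sheet_sign (val F) * g F].

(** A facet of [face_proj Fb] lifts to exactly one facet of [Fb], so that the
    two sums match term by term. *)
Lemma coboundary_pullback (n : nat) (f : cochain R M n) :
  coboundary R K n (pullback_fun f) = pullback_fun (coboundary R M n f).
Proof.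
rewrite !lfunE /=; apply/ffunP=> Fb; rewrite !ffunE.
rewrite (partition_big (@face_proj n)
  (fun G => val G \subset val (face_proj Fb))) /=;
  last by move=> F; apply: face_imageS.
rewrite mulr_sumr; apply: eq_bigr => G /facet_over[F FP].
rewrite (big_pred1 F) //; have := FP F; rewrite eqxx => /andP[FFb /eqP FG].
rewrite ffunE FG mulrA -(mulr1 (incidence _ _ _)) -(sheet_sign_sqr (val Fb)).
rewrite [_ * (_ * _)]mulrC -[_ * _ * incidence _ _ _]mulrA sheet_sign_facet //.
by rewrite -!mulrA [sheet_sign (val F) * (_ * _)]mulrA sheet_sign_sqr mul1r FG.
Qed.

(** Both sides are combinations of the values [g F] over the faces [F] above a
    facet of [Gb].  On the left [F] has weight the inverse of the cardinality
    of the fibre of [face_proj F]; on the right, the number of its cofacets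
    above [Gb] divided by the cardinality of the fibre of [Gb].  The two agree
    by [card_cofacets_over]. *)
Lemma coboundary_transfer (n : nat) (g : cochain R K n) :
  coboundary R M n (transfer g) = transfer (coboundary R K n g).
Proof.
rewrite !lfunE /=; apply/ffunP=> Gb; rewrite !ffunE.
pose term F := incidence R (val Gb) (val (face_proj F))
                 * (sheet_sign (val F) * g F).
transitivity (\sum_(F : nface K n | val (face_proj F) \subset val Gb)
  #|[set F' : nface K n | face_proj F' == face_proj F]|%:R^-1 * term F).
  rewrite [RHS](partition_big (@face_proj n)
    (fun G => val G \subset val Gb)) //=; apply: eq_bigr => G GGb.
  rewrite ffunE mulrCA !mulr_sumr; apply: eq_big => [F|F /eqP FG].
    by rewrite andb_idl // => /eqP FG; rewrite -FG in GGb.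
  by rewrite /term FG.
transitivity (#|[set Fb : nface K n.+1 | face_proj Fb == Gb]|%:R^-1
  * \sum_(F : nface K n | val (face_proj F) \subset val Gb)
      #|cofacets_over Gb F|%:R * term F).
  rewrite mulr_sumr; apply: eq_bigr => F FGb.
  rewrite [RHS]mulrA; congr (_ * term F).
  rewrite -(card_cofacets_over FGb) natrM invfM mulrC mulrA mulrV ?mul1r //.
  rewrite unitfE pnatr_eq0 -lt0n.
  have := card_fibre_gt0 Gb; rewrite -(card_cofacets_over FGb).
  by rewrite muln_gt0 => /andP[].
congr (_ * _); rewrite [RHS](eq_bigr (fun Fb : nface K n.+1 =>
    \sum_(F : nface K n | val F \subset val Fb) term F)); last first.
  move=> Fb /eqP FbGb; rewrite ffunE mulr_sumr; apply: eq_bigr => F FFb.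
  by rewrite mulrA sheet_sign_facet // -mulrA FbGb.
rewrite [RHS](exchange_big_dep
  (fun F : nface K n => val (face_proj F) \subset val Gb)) /=; last first.
  by move=> Fb F /eqP <-; apply: face_imageS.
apply: eq_bigr => F _; rewrite -sum1_card natr_sum mulr_suml.
by apply: eq_big => [Fb|Fb _]; rewrite ?inE ?mul1r.
Qed.

Lemma pullbackK (n : nat) (f : cochain R M n) : transfer (pullback_fun f) = f.
Proof.
apply/ffunP=> G; rewrite ffunE; set fib := [set F | _].
rewrite (eq_big (fun F => F \in fib) (fun=> f G))
  => [|F|F /eqP FG]; last 2 first.
- by rewrite inE.
- by rewrite ffunE FG mulrA sheet_sign_sqr mul1r.
rewrite sumr_const -[f G *+ _]mulr_natl mulrA mulVr ?mul1r //.
by rewrite unitfE pnatr_eq0 -lt0n card_fibre_gt0.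
Qed.

End Covering.

Local Close Scope ring_scope.

Theorem theorem5p2 (R : realType) (T U : finType)
    (K : scomplex T) (M : scomplex U)
    (hcov : exists phi : vertex K -> vertex M, covering phi) (i : nat) :
  betti R M i <= betti R K i.
Proof.
case: hcov => phi cov.
apply: (@betti_le_of_retraction R T U K M i
  (fun n => pullback_fun (R := R) cov (n := n)) (transfer cov)) => n.
- exact: coboundary_pullback.
- exact: coboundary_transfer.
- exact: pullbackK.
Qed.
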